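(* The unimodular simply connected Lie group $S_6^0$ admits lattices.
   Context: A lattice in a simply connected solvable Lie group $G$ is a discrete subgroup $\Gamma$ with $\Gamma\backslash G$ compact. $S_6^0$ is the simply connected Lie group $\mathbb{R}\times\mathbb{R}^{11}$ with product $(t,v)(s,w)=(t+s,v+e^{tA}w)$, where $$A=\begin{bmatrix}0_3&0\\ U&0_4\end{bmatrix}\oplus\begin{bmatrix}0&-1&0&0\\ 1&0&0&0\\ 0&0&0&1\\ 0&0&-1&0\end{bmatrix},\qquad U=\begin{bmatrix}0&0&0\\ 1&0&0\\ 0&1&0\\ 0&0&1\end{bmatrix},$$ and $\oplus$ denotes block diagonal sum. *)

(* Defs.v *)
From HB Require Import structures.
From mathcomp Require Import all_boot all_order all_algebra generic_quotient.
From mathcomp Require Import all_classical all_reals all_analysis.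
From mathcomp Require Import ring.

Set Implicit Arguments.
Unset Strict Implicit.
Unset Printing Implicit Defensive.

Import Order.TTheory GRing.Theory Num.Theory.
Import numFieldNormedType.Exports.

Local Open Scope classical_set_scope.
Local Open Scope ring_scope.

HB.structure Definition PreTopologicalGroup :=
  {G of Group G & Topological G}.

HB.mixin Record isTopologicalGroup G & PreTopologicalGroup G := {
  mulg_continuous : continuous (fun z : G * G => (z.1 * z.2)%g);
  invg_continuous : continuous (fun x : G => (x^-1)%g)
}.

#[short(type="topologicalGroupType")]
HB.structure Definition TopologicalGroup :=
  {G of PreTopologicalGroup G & isTopologicalGroup G}.

(* Any subset of G is a boolean predicate in classical logic, so that
   [groupClosed G] ranges over all the subgroups of G. *)
Section Lattice.
Variables (G : topologicalGroupType) (Gamma : groupClosed G).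

(* [rcoset_rel x y] says that Gamma x = Gamma y. *)
Definition rcoset_rel : rel G := fun x y => (x / y)%g \in Gamma.

Lemma rcoset_rel_equiv : equiv_class_of rcoset_rel.
Proof.
split=> [x|x y|y x z]; rewrite /rcoset_rel.
- by rewrite mulgV gpred1.
- by rewrite -gpredV invgM invgK.
- move=> xy yz.
  have -> : (x / z = (x / y) * (y / z))%g by rewrite mulgA mulgVK.
  exact: gpredM.
Qed.

Canonical rcoset_rel_equiv_rel := EquivRelPack rcoset_rel_equiv.

(* The set Gamma\G of right cosets Gamma x. *)
Definition rcoset_space : quotType G := {eq_quot rcoset_rel}%qT.

Definition discrete_subgroup := [set` Gamma] `<=` isolated [set` Gamma].

Definition lattice :=
  discrete_subgroup /\ compact [set: quotient_topology rcoset_space].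

End Lattice.

Definition expm (R : realType) (n : nat) (X : 'M[R]_n) : 'M[R]_n :=
  lim (series (fun k => k`!%:R^-1 *: X ^+ k) @ \oo).

Section MatrixA.
Variable R : realType.

Definition mx_of_rows m n (s : seq (seq R)) : 'M[R]_(m, n) :=
  \matrix_(i, j) nth 0 (nth [::] s i) j.

Definition U_mx : 'M[R]_(4, 3) := mx_of_rows 4 3
  [:: [:: 0; 0; 0];
      [:: 1; 0; 0];
      [:: 0; 1; 0];
      [:: 0; 0; 1]].

Definition J_mx : 'M[R]_4 := mx_of_rows 4 4
  [:: [:: 0; -1; 0; 0];
      [:: 1;  0; 0; 0];
      [:: 0;  0; 0; 1];
      [:: 0;  0; -1; 0]].

Definition A_mx : 'M[R]_11 :=
  block_mx (block_mx (0 : 'M[R]_3) (0 : 'M[R]_(3, 4)) U_mx (0 : 'M[R]_4)) 0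
           0 J_mx.

End MatrixA.
Arguments A_mx {R}.

Section A_mx_powers.
Variable R : realType.
Local Notation A := (@A_mx R).

Lemma J_mxX2 : J_mx R ^+ 2 = - 1%:M.
Proof.
apply/matrixP => i j; rewrite expr2 !mxE !big_ord_recl big_ord0 !mxE /=.
by case: i => [] [|[|[|[|//]]]] ?; case: j => [] [|[|[|[|//]]]] ? /=;
  rewrite !(mul0r, mulr0, add0r, addr0, mul1r, mulr1, mulN1r, oppr0).
Qed.

Lemma A_mxX2 :
  A ^+ 2 = block_mx 0 0 0 (- 1%:M : 'M[R]_4) :> 'M[R]_(3 + 4 + 4).
Proof.
pose N : 'M[R]_(3 + 4) := block_mx 0 0 (U_mx R) 0.
have -> : A ^+ 2 =
    block_mx N 0 0 (J_mx R) *m block_mx N 0 0 (J_mx R) :> 'M[R]_(3 + 4 + 4).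
  by rewrite expr2.
rewrite mulmx_block -[J_mx R *m J_mx R]/(J_mx R ^+ 2) J_mxX2.
rewrite !(mul0mx, mulmx0, add0r, addr0) /N mulmx_block.
by rewrite !(mul0mx, mulmx0, add0r, addr0) block_mx0.
Qed.

Lemma A_mxX4 : A ^+ 4 = - A ^+ 2.
Proof.
rewrite (exprM A 2 2) A_mxX2 expr2.
set B := block_mx _ _ _ _; have -> : (B : 'M[R]_11) * B = B *m B by [].
rewrite mulmx_block !(mul0mx, mulmx0, add0r, addr0) mulNmx mul1mx.
by rewrite (@opp_block_mx _ (3 + 4) 4 (3 + 4) 4) !oppr0.
Qed.

End A_mx_powers.

Section ExpmX4.
Variables (R : realType) (n : nat) (A : 'M[R]_n.+1).
Hypothesis AX4 : A ^+ 4 = - A ^+ 2.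

Let AX_even k : A ^+ k.*2.+2 = (-1) ^+ k *: A ^+ 2.
Proof.
elim: k => [|k IHk]; first by rewrite scale1r.
have -> : (k.+1.*2.+2 = k.*2.+2 + 2)%N by rewrite doubleS addn2.
rewrite exprD IHk -scalerAl -exprD AX4 [(-1) ^+ _.+1]exprS mulN1r.
by rewrite scalerN scaleNr.
Qed.

Let AX_odd k : A ^+ k.*2.+3 = (-1) ^+ k *: A ^+ 3.
Proof. by rewrite exprSr AX_even -scalerAl -exprSr. Qed.

Let expm_term (t : R) k : k`!%:R^-1 *: (t *: A) ^+ k =
  sin_coeff t k *: - A ^+ 3 + cos_coeff t k *: - A ^+ 2 +
  ((k == 0%N)%:R *: (1 + A ^+ 2) + ((k == 1%N)%:R * t) *: (A + A ^+ 3)).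
Proof.
rewrite exprZn scalerA mulrC /sin_coeff /cos_coeff /=.
case: k => [|[|k]] /=.
- by rewrite !(fact0, expr0, mul0r, mulr0, scale0r, mul1r, mulr1, invr1, add0r,
     addr0, scale1r) addrC addrK.
- by rewrite !(expr0, expr1, mul0r, mulr0, scale0r, mul1r, mulr1, invr1, add0r,
     addr0, divr1) scalerN scalerDr addrC addrK.
rewrite !(mul0r, scale0r, addr0) negbK.
have -> : A ^+ k.+2 =
    if odd k then (-1) ^+ k./2 *: A ^+ 3 else (-1) ^+ k./2 *: A ^+ 2.
  rewrite -[X in A ^+ X.+2]odd_double_half.
  by case: odd; [exact: AX_odd|exact: AX_even].
rewrite -[(-1) ^ _]/((-1) ^+ (k./2).+1).
case: (odd k) (uphalf_half k) => /= kE.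
  rewrite kE add1n !(mul0r, scale0r, addr0, mul1r) [(-1) ^+ _.+1]exprS mulN1r.
  by rewrite scalerN -scaleNr scalerA; congr (_ *: _); ring.
rewrite !(mul0r, scale0r, add0r, mul1r) [(-1) ^+ _.+1]exprS mulN1r.
by rewrite scalerN -scaleNr scalerA; congr (_ *: _); ring.
Qed.

Let series_expm (t : R) k :
  series (fun k => k`!%:R^-1 *: (t *: A) ^+ k) (k + 2)%N =
  series (sin_coeff t) (k + 2)%N *: - A ^+ 3 +
  series (cos_coeff t) (k + 2)%N *: - A ^+ 2 +
  (1 + A ^+ 2 + t *: (A + A ^+ 3)).
Proof.
rewrite /series /= (eq_bigr _ (fun i _ => expm_term t i)) !big_split /=.
rewrite -!scaler_suml; congr (_ + (_ + _)).
  by rewrite addn2 big_nat_recl // big1 ?addr0 ?scale1r.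
rewrite addn2 big_nat_recl // big_nat_recl // big1 ?addr0 //=.
by rewrite add0r scale1r.
Qed.

(* In particular the series defining [expm] converges here. *)
Lemma expm_X4 (t : R) : expm (t *: A) =
  1 + A ^+ 2 + t *: (A + A ^+ 3) - sin t *: A ^+ 3 - cos t *: A ^+ 2.
Proof.
rewrite /expm; apply: cvg_lim; first exact: norm_hausdorff.
rewrite -(cvg_shiftn 2) /=; under eq_fun do rewrite series_expm.
have -> : 1 + A ^+ 2 + t *: (A + A ^+ 3) - sin t *: A ^+ 3 - cos t *: A ^+ 2 =
   sin t *: - A ^+ 3 + cos t *: - A ^+ 2 + (1 + A ^+ 2 + t *: (A + A ^+ 3)).
  by rewrite !scalerN [RHS]addrC addrA.
apply: cvgD; last exact: cvg_cst.
apply: cvgD; apply: cvgZr_tmp.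
  rewrite (cvg_shiftn 2 (series (sin_coeff t))) unlock.
  exact: is_cvg_series_sin_coeff.
rewrite (cvg_shiftn 2 (series (cos_coeff t))) unlock.
exact: is_cvg_series_cos_coeff.
Qed.

Lemma expm_X4D (s t : R) :
  expm ((s + t) *: A) = expm (s *: A) *m expm (t *: A).
Proof.
have X5 : A ^+ 5 = - A ^+ 3 by rewrite exprS AX4 mulrN -exprS.
have X6 : A ^+ 6 = A ^+ 2 by rewrite exprS X5 mulrN -exprS AX4 opprK.
have expE u : expm (u *: A) = (1 + A ^+ 2) + u *: (A + A ^+ 3)
    + sin u *: (- A ^+ 3) + cos u *: (- A ^+ 2).
  by rewrite expm_X4 !scalerN.
rewrite -[_ *m _]/(_ * _) !expE sinD cosD.
set P := 1 + A ^+ 2; set N := A + A ^+ 3.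
have PP : P * P = P.
  by rewrite mulrDl mul1r mulrDr mulr1 -exprD AX4 addrN addr0.
have PN : P * N = N.
  by rewrite mulrDl mul1r mulrDr -exprSr -exprD X5 addrN addr0.
have NP : N * P = N.
  by rewrite mulrDr mulr1 mulrDl -exprS -exprD X5 addrN addr0.
have NN : N * N = 0.
  rewrite mulrDl !mulrDr -expr2 -exprS -exprSr -exprD X6 AX4.
  by rewrite addrN add0r addNr.
have P2 : P * A ^+ 2 = 0 by rewrite mulrDl mul1r -exprD AX4 addrN.
have P3 : P * A ^+ 3 = 0 by rewrite mulrDl mul1r -exprD X5 addrN.
have P2' : A ^+ 2 * P = 0 by rewrite mulrDr mulr1 -exprD AX4 addrN.
have P3' : A ^+ 3 * P = 0 by rewrite mulrDr mulr1 -exprD X5 addrN.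
have N2 : N * A ^+ 2 = 0 by rewrite mulrDl -exprS -exprD X5 addrN.
have N3 : N * A ^+ 3 = 0 by rewrite mulrDl -exprS -exprD X6 AX4 addNr.
have N2' : A ^+ 2 * N = 0 by rewrite mulrDr -exprSr -exprD X5 addrN.
have N3' : A ^+ 3 * N = 0 by rewrite mulrDr -exprSr -exprD X6 AX4 addNr.
clearbody P N.
rewrite !(mulrDl, mulrDr) -!scalerAl -!scalerAr !mulrN !mulNr.
rewrite PP PN NP NN P2 P3 P2' P3' N2 N3 N2' N3' -!exprD X5 X6 AX4.
rewrite !(oppr0, scaler0, addr0, add0r, opprK) !scalerA.
rewrite scalerBl !scalerDl !scalerN opprK.
by rewrite [LHS](AC ((1*2)*2*2) (((1*3*2)*(7*4))*(5*6))).
Qed.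

End ExpmX4.

Definition expA (R : realType) (t : R) : 'M[R]_11 := expm (t *: A_mx).

Lemma expAD (R : realType) (s t : R) : expA (s + t) = expA s *m expA t.
Proof. exact/expm_X4D/A_mxX4. Qed.

Lemma expA0 (R : realType) : expA (0 : R) = 1%:M.
Proof.
rewrite /expA (expm_X4 (A_mxX4 R)) sin0 cos0 !scale0r scale1r subr0 addr0.
by rewrite addrK.
Qed.

Lemma expAN (R : realType) (t : R) : expA t *m expA (- t) = 1%:M.
Proof. by rewrite -expAD addrN expA0. Qed.

Lemma mulmx_cV_continuous (R : realType) m n (B : 'M[R]_(m, n)) :
  continuous (fun v : 'cV[R]_n => B *m v).
Proof.
have -> : (fun v : 'cV[R]_n => B *m v) =
    (fun v => \sum_(k < n) v k ord0 *: col k B).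
  apply/funext => v; apply/matrixP => i j.
  rewrite !mxE summxE; apply: eq_bigr => k _.
  by rewrite !mxE mulrC (ord1 j).
apply: continuous_big => [v|k _ v]; first exact: add_continuous.
apply: cvgZr_tmp; first exact: (nbhs_filter v).
exact: (@coord_continuous R n 1 k ord0 v).
Qed.

Lemma cvg_pairE (T : Type) (F : set_system T) (FF : Filter F)
    (U V : topologicalType) (f : T -> U) (g : T -> V) (a : U) (b : V) :
  f x @[x --> F] --> a -> g x @[x --> F] --> b ->
  (f x, g x) @[x --> F] --> ((a, b) : U * V).
Proof. exact: cvg_pair. Qed.

Lemma cvg_expA_mul (R : realType) (T : Type) (F : set_system T)
    (FF : Filter F) (f : T -> R) (g : T -> 'cV[R]_11) (a : R) (b : 'cV[R]_11) :
  f x @[x --> F] --> a -> g x @[x --> F] --> b ->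
  expA (f x) *m g x @[x --> F] --> expA a *m b.
Proof.
move=> fa gb.
have expAE t (v : 'cV[R]_11) : expA t *m v =
    (1 + A_mx ^+ 2) *m v + t *: ((A_mx + A_mx ^+ 3) *m v) -
    sin t *: (A_mx ^+ 3 *m v) - cos t *: (A_mx ^+ 2 *m v).
  by rewrite /expA (expm_X4 (A_mxX4 R)) !mulmxBl 2!mulmxDl -!scalemxAl.
have gB (B : 'M[R]_11) : B *m g x @[x --> F] --> B *m b.
  exact: (continuous_cvg _ (@mulmx_cV_continuous R _ _ B b) gb).
have cs : sin (f x) @[x --> F] --> sin a.
  exact: (continuous_cvg _ (@continuous_sin R a) fa).
have cc : cos (f x) @[x --> F] --> cos a.
  exact: (continuous_cvg _ (@continuous_cos R a) fa).
rewrite expAE; under eq_fun do rewrite expAE.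
apply: cvgB; last exact: cvgZ.
apply: cvgB; last exact: cvgZ.
by apply: cvgD; [exact: gB|exact: cvgZ].
Qed.

Definition S60 (R : realType) : Type := (R * 'cV[R]_11)%type.
HB.instance Definition _ (R : realType) :=
  Topological.copy (S60 R) (R * 'cV[R]_11)%type.

Section S60_group.
Variable R : realType.
Implicit Types x y z : S60 R.

Definition S60_mul x y : S60 R := (x.1 + y.1, x.2 + expA x.1 *m y.2).
Definition S60_one : S60 R := (0, 0).
Definition S60_inv x : S60 R := (- x.1, - (expA (- x.1) *m x.2)).

Lemma S60_mulA : associative S60_mul.
Proof.
move=> x y z; congr pair; rewrite /= ?addrA //.
by rewrite mulmxDr mulmxA -expAD addrA.
Qed.

Lemma S60_mul1 : left_id S60_one S60_mul.
Proof.
by move=> [t v]; rewrite /S60_mul /= !add0r expA0 mul1mx.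
Qed.

Lemma S60_mulr1 : right_id S60_one S60_mul.
Proof. by move=> [t v]; rewrite /S60_mul /= mulmx0 !addr0. Qed.

Lemma S60_mulV : left_inverse S60_one S60_inv S60_mul.
Proof. by move=> [t v]; rewrite /S60_mul /= !addNr. Qed.

Lemma S60_mulVr : right_inverse S60_one S60_inv S60_mul.
Proof.
by move=> [t v]; rewrite /S60_mul /= mulmxN mulmxA expAN mul1mx !addrN.
Qed.

HB.instance Definition _ := isGroup.Build (S60 R)
  S60_mulA S60_mul1 S60_mulr1 S60_mulV S60_mulVr.

Lemma S60_mul_continuous : continuous (fun z : S60 R * S60 R => (z.1 * z.2)%g).
Proof.
move=> z.
have f1 : (fun y : S60 R * S60 R => y.1 : R * 'cV[R]_11) y @[y --> z] --> z.1.
  exact: cvg_fst.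
have f2 : (fun y : S60 R * S60 R => y.2 : R * 'cV[R]_11) y @[y --> z] --> z.2.
  exact: cvg_snd.
have c11 : (y.1.1 : R) @[y --> z] --> z.1.1.
  by apply: (cvg_comp _ _ f1); exact: cvg_fst.
have c12 : (y.1.2 : 'cV[R]_11) @[y --> z] --> z.1.2.
  by apply: (cvg_comp _ _ f1); exact: cvg_snd.
have c21 : (y.2.1 : R) @[y --> z] --> z.2.1.
  by apply: (cvg_comp _ _ f2); exact: cvg_fst.
have c22 : (y.2.2 : 'cV[R]_11) @[y --> z] --> z.2.2.
  by apply: (cvg_comp _ _ f2); exact: cvg_snd.
change ((y.1.1 + y.2.1, y.1.2 + expA y.1.1 *m y.2.2) @[y --> z] -->
  ((z.1.1 + z.2.1, z.1.2 + expA z.1.1 *m z.2.2) : R * 'cV[R]_11)).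
apply: cvg_pairE; first exact: cvgD.
by apply: cvgD => //; exact: cvg_expA_mul.
Qed.

Lemma S60_inv_continuous : continuous (fun x : S60 R => (x^-1)%g).
Proof.
move=> z; have c1 : (y.1 : R) @[y --> z] --> z.1 by exact: cvg_fst.
have c2 : (y.2 : 'cV[R]_11) @[y --> z] --> z.2 by exact: cvg_snd.
change ((- y.1, - (expA (- y.1) *m y.2)) @[y --> z] -->
  ((- z.1, - (expA (- z.1) *m z.2)) : R * 'cV[R]_11)).
apply: cvg_pairE; first exact: cvgN.
by apply: cvgN; apply: cvg_expA_mul => //; exact: cvgN.
Qed.

HB.instance Definition _ := isTopologicalGroup.Build (S60 R)
  S60_mul_continuous S60_inv_continuous.

(* The underlying space contracts to a point, so that S60 is simply connected. *)
Lemma S60_contractible : exists H : R * S60 R -> S60 R,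
  [/\ continuous H, forall x, H (0, x) = x & forall x, H (1, x) = 1%g].
Proof.
exists (fun p => ((1 - p.1) * p.2.1, (1 - p.1) *: p.2.2)); split.
- move=> z.
  have cr : 1 - y.1 @[y --> z] --> 1 - z.1.
    by apply: cvgB; [exact: cvg_cst|exact: cvg_fst].
  have f2 : (fun y : R * S60 R => y.2 : R * 'cV[R]_11) y @[y --> z] --> z.2.
    exact: cvg_snd.
  have c1 : (y.2.1 : R) @[y --> z] --> z.2.1.
    by apply: (cvg_comp _ _ f2); exact: cvg_fst.
  have c2 : (y.2.2 : 'cV[R]_11) @[y --> z] --> z.2.2.
    by apply: (cvg_comp _ _ f2); exact: cvg_snd.
  by apply: cvg_pairE; [exact: cvgM|exact: cvgZ].
- by move=> [t v] /=; rewrite subr0 mul1r scale1r.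
- by move=> [t v] /=; rewrite subrr mul0r scale0r.
Qed.

(* The Lie algebra of S60 is R x R^11 with bracket
   [(a, x), (b, y)] = (0, a A y - b A x); S60_ad (a, x) is the matrix of
   ad (a, x) in block form. *)
Definition S60_ad x : 'M[R]_(1 + 11) :=
  block_mx 0 0 (- (A_mx *m x.2)) (x.1 *: A_mx).

(* S60 being connected, this says that it is unimodular. *)
Lemma S60_unimodular x : \tr (S60_ad x) = 0.
Proof.
rewrite /S60_ad mxtrace_block mxtrace0 add0r mxtraceZ.
rewrite (@mxtrace_block _ (3 + 4) 4) mxtrace_block !mxtrace0 !add0r.
by rewrite /mxtrace !big_ord_recl big_ord0 !mxE /= !addr0 mulr0.
Qed.

End S60_group.

(* Main.v *)
(** At [t = 2 pi] the rotation block of [expA] is trivial, so that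
    [expA (2 k pi) = 1 + 2 k pi N] with [N] the nilpotent part of [A]. Rescaling
    by [2 pi] the four coordinates in the image of [N] turns these matrices into
    integral ones: they preserve [L = Z^3 x (2 pi Z)^4 x Z^4], and
    [2 pi Z x L] is the lattice. A fundamental domain is contained in a box. *)
From HB Require Import structures.
Require Import Defs.
From mathcomp Require Import all_boot all_order all_algebra generic_quotient.
From mathcomp Require Import all_classical all_reals all_analysis.
From mathcomp Require Import ring.

Set Implicit Arguments.
Unset Strict Implicit.
Unset Printing Implicit Defensive.

Import Order.TTheory GRing.Theory Num.Theory.
Import numFieldNormedType.Exports.

Local Open Scope classical_set_scope.
Local Open Scope ring_scope.

(** * Integer multiples, compact boxes and the nilpotent part of [A] *)

Section S60Lattice.
Variable R : realType.

(** The difference is an integer multiple of [c], and a nonzero one would have absolute value at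
    least [c], hence at least 1. This gives discreteness. *)
Lemma int_multiple_eq (c a b : R) : 1 <= c ->
  a / c \is a Num.int -> b / c \is a Num.int -> `|a - b| < 1 -> a = b.
Proof.
move=> c1 ac bc ab; have c0 : 0 < c by exact: lt_le_trans c1.
apply/eqP; rewrite -subr_eq0 -[_ - _](divfK (lt0r_neq0 c0)) mulf_eq0.
rewrite (gt_eqF c0) orbF; apply: contraTT ab => abN0; rewrite -leNgt.
have abZ : (a - b) / c \is a Num.int by rewrite mulrBl rpredB.
rewrite -[a - b](divfK (lt0r_neq0 c0)) normrM (gtr0_norm c0).
by rewrite mulr_ege1 // norm_intr_ge1.
Qed.

(** The upper bound is kept weak so that remainders fall in a closed, hence compact, interval. *)
Lemma floor_remainder (c t : R) : 0 < c ->
  0 <= t - c * (Num.floor (t / c))%:~R <= c.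
Proof.
move=> c0; have /andP[le_t lt_t] := floor_itv (t / c).
rewrite subr_ge0 mulrC -ler_pdivlMr // le_t /=.
rewrite lerBlDr -[X in X + _]mul1r -mulrDl -ler_pdivrMr //.
by move: lt_t; rewrite intrD addrC => /ltW.
Qed.

Lemma trmx_continuous m n : continuous (@trmx R m n).
Proof.
move=> M B /= /nbhs_ballP[e e0 eB]; apply/nbhs_ballP; exists e => //= M' [_ MM'].
by apply: eB; split=> // i j; rewrite !mxE.
Qed.

Lemma cV_box_compact n (d : 'I_n -> R) :
  compact [set v : 'cV[R]_n | forall i, v i ord0 \in `[0, d i]].
Proof.
set B := [set v | _].
pose B' := [set v : 'rV[R]_n | forall i, v ord0 i \in `[0, d i]].
have -> : B = trmx @` B'.
  (* Compactness of products comes from [rV_compact], stated for row vectors; the column box is its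
     image under transposition. *)
  apply/seteqP; split=> [v Bv|_ [v B'v <-] i]; last by rewrite mxE; exact: B'v.
  by exists v^T; rewrite ?trmxK // => i; rewrite mxE; exact: Bv.
apply: continuous_compact; first exact/continuous_subspaceT/trmx_continuous.
apply: (@rV_compact R n (fun i => `[0, d i]%classic)) => i.
exact: segment_compact.
Qed.

(* The rotation block [J] of [A] satisfies [J ^+ 3 = - J], so it cancels here. *)
Definition A_nil : 'M[R]_11 := A_mx + A_mx ^+ 3.

Lemma A_nilE :
  A_nil = block_mx (block_mx 0 0 (U_mx R) 0) 0 0 0 :> 'M[R]_(3 + 4 + 4).
Proof.
rewrite /A_nil exprS A_mxX2 /A_mx.
set B := block_mx 0 0 0 _; set C := block_mx _ _ _ _.
rewrite -[C * B]/(C *m B) mulmx_block !(mul0mx, mulmx0, add0r, addr0).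
by rewrite mulmxN mulmx1 (@add_block_mx _ (3 + 4) 4 (3 + 4) 4) !addr0 addrN.
Qed.


(** * Values of [expA] at multiples of [2 pi] *)

Lemma sincos_2pi_int (k : int) :
  sin (pi *+ 2 * k%:~R : R) = 0 /\ cos (pi *+ 2 * k%:~R : R) = 1.
Proof.
have sincosn n : sin (pi *+ 2 * n%:R : R) = 0 /\ cos (pi *+ 2 * n%:R : R) = 1.
  rewrite mulr_natr -[_ *+ n]add0r (periodicn (@sinD2pi R)).
  by rewrite (periodicn (@cosD2pi R)) sin0 cos0.
case: k => n; first exact: sincosn.
have [s0 c1] := sincosn n.+1.
by rewrite NegzE rmorphN mulrN sinN cosN /= -pmulrn s0 c1 oppr0.
Qed.

(** With sine 0 and cosine 1, the two [A ^+ 2] terms of [expm_X4] cancel. *)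
Lemma expA_2pi (k : int) :
  expA (pi *+ 2 * k%:~R) = 1%:M + (pi *+ 2 * k%:~R) *: A_nil.
Proof.
have [s0 c1] := sincos_2pi_int k.
rewrite /expA (expm_X4 (A_mxX4 R)) s0 c1 scale0r subr0 scale1r.
by rewrite addrAC addrK.
Qed.

(** * The group [L] of vectors and its invariance *)

Definition scale_cV : 'cV[R]_11 :=
  col_mx (col_mx (const_mx 1 : 'cV_3) (const_mx (pi *+ 2) : 'cV_4))
    (const_mx 1 : 'cV_4).

Lemma pi2_ge1 : 1 <= pi *+ 2 :> R.
Proof.
rewrite mulr2n; apply: le_trans (lerD (pi_ge2 R) (pi_ge2 R)).
by rewrite -natrD ler1n.
Qed.

Lemma pi2_gt0 : 0 < pi *+ 2 :> R.
Proof. exact: lt_le_trans pi2_ge1. Qed.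

Lemma scale_cV_ge1 i : 1 <= scale_cV i ord0.
Proof.
rewrite /scale_cV; case: (@split_ordP (3 + 4) 4 i) => j ->.
  rewrite (@col_mxEu _ (3 + 4)); case: (@split_ordP 3 4 j) => l ->.
    by rewrite col_mxEu mxE.
  by rewrite col_mxEd mxE pi2_ge1.
by rewrite (@col_mxEd _ (3 + 4)) mxE.
Qed.

Lemma scale_cV_gt0 i : 0 < scale_cV i ord0.
Proof. exact: lt_le_trans (scale_cV_ge1 i). Qed.

Lemma U_mx_int i j : U_mx R i j \is a Num.int.
Proof.
rewrite mxE; case: i => [] [|[|[|[|//]]]] ?; case: j => [] [|[|[|//]]] ? /=;
  by rewrite ?int_num0 ?int_num1.
Qed.

(** These are the entries of [2 pi D^-1 N D], where [D] is the diagonal matrix of [scale_cV]. The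
    only nonzero block of [N] is [U], which maps coordinates of scale 1 to coordinates of scale
    [2 pi]; the two factors [2 pi] cancel and leave the entries of [U]. *)
Lemma A_nil_scale_int i j :
  pi *+ 2 * A_nil i j * scale_cV j ord0 / scale_cV i ord0 \is a Num.int.
Proof.
rewrite A_nilE /scale_cV.
case: (@split_ordP (3 + 4) 4 i) => {}i ->;
  case: (@split_ordP (3 + 4) 4 j) => {}j ->.
- rewrite (@block_mxEul _ (3 + 4) 4 (3 + 4)) !(@col_mxEu _ (3 + 4)).
  case: (@split_ordP 3 4 i) => {}i ->; case: (@split_ordP 3 4 j) => {}j ->.
  + by rewrite block_mxEul mxE mulr0 !mul0r rpred0.
  + by rewrite block_mxEur mxE mulr0 !mul0r rpred0.
  + rewrite block_mxEdl col_mxEu col_mxEd ![const_mx _ _ _]mxE mulr1.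
    by rewrite mulrAC divff ?gt_eqF ?pi2_gt0 // mul1r U_mx_int.
  + by rewrite block_mxEdr mxE mulr0 !mul0r rpred0.
- by rewrite (@block_mxEur _ (3 + 4) 4 (3 + 4)) mxE mulr0 !mul0r rpred0.
- by rewrite (@block_mxEdl _ (3 + 4) 4 (3 + 4)) mxE mulr0 !mul0r rpred0.
- by rewrite (@block_mxEdr _ (3 + 4) 4 (3 + 4)) mxE mulr0 !mul0r rpred0.
Qed.

Definition cV_lattice : {pred 'cV[R]_11} :=
  fun v => [forall i, v i ord0 / scale_cV i ord0 \is a Num.int].

Implicit Types v w : 'cV[R]_11.

Lemma cV_latticeP v :
  reflect (forall i, v i ord0 / scale_cV i ord0 \is a Num.int)
    (v \in cV_lattice).
Proof. exact: forallP. Qed.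

Lemma cV_lattice0 : 0 \in cV_lattice.
Proof. by apply/cV_latticeP => i; rewrite mxE mul0r rpred0. Qed.

Lemma cV_latticeD v w :
  v \in cV_lattice -> w \in cV_lattice -> v + w \in cV_lattice.
Proof.
move=> /cV_latticeP vL /cV_latticeP wL; apply/cV_latticeP => i.
by rewrite mxE mulrDl rpredD.
Qed.

Lemma cV_latticeN v : v \in cV_lattice -> - v \in cV_lattice.
Proof.
move=> /cV_latticeP vL; apply/cV_latticeP => i.
by rewrite mxE mulNr rpredN.
Qed.

(** This invariance makes [2 pi Z x L] closed under the twisted product and inverse. *)
Lemma cV_lattice_expA (t : R) v :
  t / (pi *+ 2) \is a Num.int -> v \in cV_lattice -> expA t *m v \in cV_lattice.
Proof.
move=> /intrP[k tk] vL.
have -> : t = pi *+ 2 * k%:~R by rewrite mulrC -tk divfK ?gt_eqF ?pi2_gt0.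
rewrite expA_2pi mulmxDl mul1mx cV_latticeD //; apply/cV_latticeP => i.
rewrite -scalemxAl 2!mxE mulr_sumr mulr_suml rpred_sum // => j _.
(* Inserting the scale of coordinate [j] splits each summand into three integers. *)
have -> : pi *+ 2 * k%:~R * (A_nil i j * v j ord0) / scale_cV i ord0 =
    k%:~R * (pi *+ 2 * A_nil i j * scale_cV j ord0 / scale_cV i ord0) *
    (v j ord0 / scale_cV j ord0).
  by field; rewrite !gt_eqF ?scale_cV_gt0.
apply: rpredM; last exact: (cV_latticeP _ vL).
by apply: rpredM; [exact: intr_int|exact: A_nil_scale_int].
Qed.

(** * The subgroup [2 pi Z x L] and its discreteness *)

Definition S60_lattice : {pred S60 R} :=
  fun x => (x.1 / (pi *+ 2) \is a Num.int) && (x.2 \in cV_lattice).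

Lemma S60_lattice1 : 1%g \in S60_lattice.
Proof. by rewrite unfold_in /= mul0r rpred0 cV_lattice0. Qed.

Lemma S60_latticeM : mulg_closed S60_lattice.
Proof.
move=> x y /andP[x1 x2] /andP[y1 y2]; apply/andP; split=> /=.
  by rewrite mulrDl rpredD.
by rewrite cV_latticeD // cV_lattice_expA.
Qed.

Lemma S60_latticeV : invg_closed S60_lattice.
Proof.
move=> x /andP[x1 x2]; apply/andP; split=> /=; first by rewrite mulNr rpredN.
by rewrite cV_latticeN // cV_lattice_expA // mulNr rpredN.
Qed.

HB.instance Definition _ := isMulClosed.Build (S60 R) S60_lattice S60_latticeM.
HB.instance Definition _ := isMul1Closed.Build (S60 R) S60_lattice S60_lattice1.
HB.instance Definition _ := isInvClosed.Build (S60 R) S60_lattice S60_latticeV.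

Lemma S60_lattice_discrete :
  discrete_subgroup (S60_lattice : groupClosed (S60 R)).
Proof.
move=> x xL; split; first by rewrite inE.
(* Radius 1 suffices in every coordinate, since all the spacings, 1 or [2 pi], are at least 1. *)
pose U : set (S60 R) := [set y | ball x.1 1 y.1 /\ ball x.2 1 y.2].
exists U.
  exists (ball x.1 1, ball x.2 1); last by case=> ? ? [].
  by split; exact: nbhsx_ballx.
apply/seteqP; split=> [y [[xy1 [_ xy2]] yL]|_ ->]; last first.
  by split=> //; split; exact: ballxx.
case/andP: xL => x1 /cV_latticeP x2; case/andP: yL => y1 /cV_latticeP y2.
rewrite [x]surjective_pairing [y]surjective_pairing /=; congr pair.
  by apply/esym; exact: int_multiple_eq pi2_ge1 x1 y1 xy1.
apply/matrixP => i j; rewrite ord1; apply/esym.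
exact: int_multiple_eq (scale_cV_ge1 i) (x2 i) (y2 i) (xy2 i ord0).
Qed.

(** * Cocompactness *)

Definition S60_box : set (S60 R) :=
  [set t | t \in `[0, pi *+ 2]] `*`
  [set v : 'cV[R]_11 | forall i, v i ord0 \in `[0, scale_cV i ord0]].

Lemma S60_box_compact : compact S60_box.
Proof. exact: compact_setX (@segment_compact _ _ _) (@cV_box_compact _ _). Qed.

Lemma S60_box_cover (x : S60 R) :
  exists2 y, y \in S60_lattice & S60_box (y * x)%g.
Proof.
pose fl (c t : R) : R := c * (Num.floor (t / c))%:~R.
have flZ c t : 0 < c -> fl c t / c \is a Num.int.
  by move=> c0; rewrite /fl mulrC mulKf ?gt_eqF // intr_int.
(* Left translation by [(- s, - w)] turns the vector part into [- w + expA (- s) *m x.2], so [w] is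
   rounded from the already rotated and sheared vector [u], not from [x.2]. *)
pose s := fl (pi *+ 2) x.1; pose u := expA (- s) *m x.2.
pose w : 'cV[R]_11 := \col_i fl (scale_cV i ord0) (u i ord0).
exists (- s, - w).
  apply/andP; split=> /=; first by rewrite mulNr rpredN flZ ?pi2_gt0.
  by apply/cV_latticeN/cV_latticeP => i; rewrite mxE flZ ?scale_cV_gt0.
split=> [|i] /=; rewrite in_itv /=.
  by rewrite addrC floor_remainder ?pi2_gt0.
rewrite addrC -/u mxE [(- w) _ _]mxE [w _ _]mxE.
by rewrite floor_remainder ?scale_cV_gt0.
Qed.

Lemma S60_lattice_cocompact :
  compact [set: quotient_topology
    (rcoset_space (S60_lattice : groupClosed (S60 R)))].
Proof.
set Q := quotient_topology _.
have -> : [set: Q] = \pi_Q%qT @` S60_box.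
  apply/seteqP; split=> // q _; have [y yL yq] := S60_box_cover (repr q).
  (* The box point and [repr q] differ by the left factor [y] of the subgroup, so they lie in the
     same right coset. *)
  exists (y * repr q)%g => //; rewrite -[RHS]reprK; apply/eqmodP.
  by rewrite /= /rcoset_rel mulgK.
apply: continuous_compact S60_box_compact.
exact/continuous_subspaceT/pi_continuous.
Qed.

End S60Lattice.

Theorem proposition6p8 (R : realType) :
  exists Gamma : groupClosed (S60 R), lattice Gamma.
Proof.
exists (@S60_lattice R : groupClosed _).
by split; [exact: S60_lattice_discrete|exact: S60_lattice_cocompact].
Qed.
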